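(* Let $Q^*$ be an optimal solution to (DREG). Then for any $C>\max_i d_i$, the tightest bound offered by Gershgorin is $\operatorname{rank}Q^*\ge \frac n2$. Furthermore, this bound is tight.
   Context: $G=(V,E)$ is a simple undirected graph with $V=\{1,\dots,n\}$, and $d_i$ is the degree of vertex $i$. For distinct $i,j$ write $i\sim j$ if $\{i,j\}\in E$ and $i\not\sim j$ otherwise; sums over $i\sim j$, $i\not\sim j$, $i\ne j$ are over ordered pairs of distinct indices. $C$ is a real scalar parameter. (DREG): minimize $\sum_{i\sim j}s_{ij}+\sum_{i\not\sim j}v_{ij}+\sum_{i\ne j}u_{ij}$ subject to $s_{ij}\ge -1-\log r_{ij}$ for all $i\sim j$; $v_{ij}\ge -1-\log u_{ij}$ for all $i\not\sim j$; $u_{ij}-r_{ij}=Q_{ij}$ and $u_{ij},r_{ij}\ge 0$ for all $i\ne j$; $Q_{ii}=C$ for all $i$; $Q$ real symmetric positive semidefinite. ''Optimal solution $Q^*$'' refers to the matrix component. ''Bound offered by Gershgorin'' refers to the following method of bounding $\operatorname{rank}Q^*$ from below: one has $\operatorname{rank}Q^*\ge \operatorname{tr}Q^*/\|Q^*\|$ with $\|\cdot\|$ the operator norm, $\operatorname{tr}Q^*=nC$, and $\|Q^*\|$ is bounded above by the Gershgorin disks theorem. The first assertion is meant in the sense that, for such $C$, this method cannot show that $\operatorname{rank}Q^*>\frac n2$.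
   Formalization: The first assertion is proved for graphs with at least one edge: for an edgeless graph and any C > 0, Q* = C·I is optimal and Gershgorin gives rank Q* ≥ n > n/2, so the claim as written fails there. *)

(* Defs.v *)
From mathcomp Require Import all_boot all_order all_algebra.
From mathcomp Require Import all_classical all_reals all_analysis.

Set Implicit Arguments.
Unset Strict Implicit.
Unset Printing Implicit Defensive.

Import Order.TTheory GRing.Theory Num.Theory.
Local Open Scope classical_set_scope.
Local Open Scope ring_scope.

Definition simple_graph (n : nat) (e : rel 'I_n) : Prop :=
  symmetric e /\ irreflexive e.

(* On an edgeless graph C%:M is optimal for (DREG) and its Gershgorin bound
   below is n, so a bound of n/2 can only be expected when there is an edge. *)
Definition has_edge (n : nat) (e : rel 'I_n) : Prop :=
  exists i j : 'I_n, e i j.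

Definition degree (n : nat) (e : rel 'I_n) (i : 'I_n) : nat :=
  #|[set j | e i j]%SET|.

Definition max_degree (n : nat) (e : rel 'I_n) : nat :=
  (\max_(i < n) degree e i)%N.

Definition psd (R : realType) (n : nat) (Q : 'M[R]_n) : Prop :=
  Q^T = Q /\ forall x : 'cV[R]_n, 0 <= (x^T *m Q *m x) 0 0.

(* The entries of dS outside adjacent pairs, of dV outside distinct
   non-adjacent pairs, and of dU, dR on the diagonal are neither constrained
   nor counted in the objective. *)
Record dreg_point (R : realType) (n : nat) := DregPoint {
  dQ : 'M[R]_n;
  dS : 'M[R]_n;
  dV : 'M[R]_n;
  dU : 'M[R]_n;
  dR : 'M[R]_n
}.

Definition dreg_objective (R : realType) (n : nat) (e : rel 'I_n)
    (p : dreg_point R n) : R :=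
  \sum_(i < n) \sum_(j < n | e i j) dS p i j
  + \sum_(i < n) \sum_(j < n | (i != j) && ~~ e i j) dV p i j
  + \sum_(i < n) \sum_(j < n | i != j) dU p i j.

(* The extended logarithm lne sends 0 to -oo, whereas ln 0 = 0; thus s_ij
   (resp. v_ij) being real forces r_ij > 0 (resp. u_ij > 0). *)
Definition dreg_feasible (R : realType) (n : nat) (e : rel 'I_n) (C : R)
    (p : dreg_point R n) : Prop :=
  [/\ forall i j : 'I_n, e i j ->
        (- 1%:E - lne (dR p i j)%:E <= (dS p i j)%:E)%E,
      forall i j : 'I_n, i != j -> ~~ e i j ->
        (- 1%:E - lne (dU p i j)%:E <= (dV p i j)%:E)%E,
      forall i j : 'I_n, i != j ->
        [/\ dU p i j - dR p i j = dQ p i j, 0 <= dU p i j & 0 <= dR p i j],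
      forall i : 'I_n, dQ p i i = C
    & psd (dQ p)].

Definition dreg_optimal (R : realType) (n : nat) (e : rel 'I_n) (C : R)
    (Q : 'M[R]_n) : Prop :=
  exists p : dreg_point R n,
    [/\ dQ p = Q, dreg_feasible e C p
      & forall q : dreg_point R n, dreg_feasible e C q ->
          dreg_objective e p <= dreg_objective e q].

(* Only the real points of the disks matter, as Q is real symmetric. *)
Definition gershgorin_disk (R : realType) (n : nat) (Q : 'M[R]_n) (i : 'I_n) :
    set R :=
  [set z | `|z - Q i i| <= \sum_(j < n | j != i) `|Q i j|].

(* The operator norm of a symmetric matrix is its largest absolute eigenvalue;
   this is the best upper bound on it that follows from the eigenvalues lying
   in the union of the Gershgorin disks. *)
Definition gershgorin_norm_bound (R : realType) (n : nat) (Q : 'M[R]_n) : R :=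
  sup [set `|z| | z in \bigcup_(i in [set: 'I_n]) gershgorin_disk Q i].

(* Lower bound on the rank from rank Q >= tr Q / ||Q||. *)
Definition gershgorin_rank_bound (R : realType) (n : nat) (Q : 'M[R]_n) : R :=
  \tr Q / gershgorin_norm_bound Q.

(* Main.v *)
(** If all the off-diagonal absolute row sums of an optimal [Q] were below [C],
    then [Q] would be strictly diagonally dominant and an edge entry could still
    be decreased, lowering the objective. So some Gershgorin disk reaches [2C],
    and the rank bound is at most [nC / 2C]. For a perfect matching and [C > 1],
    the optimum sets [-C] on the matched pairs and [0] on the others: every disk
    then reaches exactly [2C], and the rank is [n/2]. *)
Require Import Defs.
From mathcomp Require Import all_boot all_order all_algebra.
From mathcomp Require Import all_classical all_reals all_analysis.
From mathcomp Require Import ring lra zify.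

Import Order.TTheory GRing.Theory Num.Theory.
Local Open Scope ring_scope.

(** * Positive semidefinite matrices and diagonal dominance *)

Lemma quad_formE (R : realType) (n : nat) (Q : 'M[R]_n) (x : 'cV[R]_n) :
  (x^T *m Q *m x) 0 0 = \sum_i \sum_j Q i j * (x i 0 * x j 0).
Proof.
rewrite mxE exchange_big; apply: eq_bigr => j _.
rewrite mxE mulr_suml; apply: eq_bigr => i _.
by rewrite !mxE mulrCA -mulrA.
Qed.

(** From |x_i x_j| <= (x_i^2 + x_j^2) / 2 and symmetry, the form is at least the sum of (Q_ii -
    radius_i) x_i^2. *)
Lemma diag_dominant_psd (R : realType) (n : nat) (Q : 'M[R]_n) :
  Q^T = Q -> (forall i, \sum_(j < n | j != i) `|Q i j| <= Q i i) -> psd Q.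
Proof.
move=> Qs Qd; split=> // x; rewrite quad_formE.
have Qsym i j : Q i j = Q j i by rewrite -{1}Qs mxE.
pose a i := x i 0 ^+ 2.
have lower i : Q i i * a i - \sum_(j < n | j != i) `|Q i j| * ((a i + a j) / 2)
    <= \sum_j Q i j * (x i 0 * x j 0).
  rewrite [leRHS](bigD1 i) //= -[x i 0 * x i 0]expr2 lerD2l -sumrN.
  apply: ler_sum => j _.
  have : `|Q i j * (x i 0 * x j 0)| <= `|Q i j| * ((a i + a j) / 2).
    rewrite normrM; apply: ler_wpM2l => //; rewrite ler_norml /a.
    have := sqr_ge0 (x i 0 - x j 0); have := sqr_ge0 (x i 0 + x j 0).
    by rewrite !expr2 => ? ?; apply/andP; split; nra.
  by rewrite ler_norml => /andP[].
apply: le_trans (ler_sum _ (fun i _ => lower i)).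
(* Since |Q| is symmetric, averaging [F] with its transpose leaves the weighted sum unchanged. *)
have half (F : 'I_n -> 'I_n -> R) :
    \sum_i \sum_(j < n | j != i) `|Q i j| * ((F i j + F j i) / 2)
    = \sum_i \sum_(j < n | j != i) `|Q i j| * F i j.
  have swap : \sum_i \sum_(j < n | j != i) `|Q i j| * F j i
      = \sum_i \sum_(j < n | j != i) `|Q i j| * F i j.
    rewrite (exchange_big_dep xpredT) //=; apply: eq_bigr => j _.
    by apply: eq_big => [i|i _]; rewrite 1?eq_sym // Qsym.
  have -> : \sum_i \sum_(j < n | j != i) `|Q i j| * ((F i j + F j i) / 2)
      = (\sum_i \sum_(j < n | j != i) `|Q i j| * F i j
         + \sum_i \sum_(j < n | j != i) `|Q i j| * F j i) / 2.
    rewrite -big_split mulr_suml; apply: eq_bigr => i _ /=.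
    rewrite -big_split mulr_suml; apply: eq_bigr => j _ /=; lra.
  rewrite swap; lra.
rewrite sumrB (half (fun i _ => a i)) -sumrB; apply: sumr_ge0 => i _.
by rewrite -mulr_suml -mulrBl mulr_ge0 ?sqr_ge0 // subr_ge0.
Qed.

(** Evaluate the quadratic form at the sum of the basis vectors i and j. *)
Lemma psd_offdiag_ge (R : realType) (n : nat) (Q : 'M[R]_n) (i j : 'I_n) :
  psd Q -> - (Q i i + Q j j) <= 2 * Q i j.
Proof.
move=> [Qs /(_ (delta_mx i 0 + delta_mx j 0))].
have Qsym : Q j i = Q i j by rewrite -{1}Qs mxE.
rewrite [(_ + _)^T]linearD /= !trmx_delta mulmxDl -!rowE mulmxDr -!colE.
rewrite !mxE Qsym; lra.
Qed.

(** * Evaluating the Gershgorin bound *)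

Lemma gershgorin_norm_bound_ge (R : realType) (n : nat) (Q : 'M[R]_n)
    (i : 'I_n) :
  0 <= Q i i ->
  Q i i + \sum_(j < n | j != i) `|Q i j| <= gershgorin_norm_bound Q.
Proof.
move=> Qi; set r := \sum_(_ < _ | _) _.
have r0 : 0 <= r by apply: sumr_ge0.
apply: ub_le_sup; last first.
  exists (Q i i + r); last by rewrite ger0_norm // addr_ge0.
  by exists i => //; rewrite /gershgorin_disk /= addrC addKr ger0_norm.
(* The supremum dominates a member only if the set is bounded; the sum over all rows is a crude
   bound that avoids a maximum. *)
exists (\sum_k (`|Q k k| + \sum_(j < n | j != k) `|Q k j|)).
move=> _ [z [k _ zk] <-].
have -> : z = (z - Q k k) + Q k k by rewrite subrK.
apply: le_trans (ler_normD _ _) _; rewrite addrC (bigD1 k) //=.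
rewrite -[leLHS]addr0; apply: lerD; first by rewrite lerD2l.
by apply: sumr_ge0 => l _; rewrite addr_ge0 // sumr_ge0.
Qed.

Lemma gershgorin_norm_bound_le (R : realType) (n : nat) (Q : 'M[R]_n) (M : R) :
  (0 < n)%N ->
  (forall i, `|Q i i| + \sum_(j < n | j != i) `|Q i j| <= M) ->
  gershgorin_norm_bound Q <= M.
Proof.
case: n Q => // n Q _ QM; apply: ge_sup.
  exists `|Q 0 0|; exists (Q 0 0) => //; exists 0 => //.
  by rewrite /gershgorin_disk /= subrr normr0 sumr_ge0.
move=> _ [z [k _ zk] <-]; apply: le_trans (QM k).
have -> : z = (z - Q k k) + Q k k by rewrite subrK.
by apply: le_trans (ler_normD _ _) _; rewrite addrC lerD2l.
Qed.

(** * Optimal solutions have a large Gershgorin radius *)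

Lemma lne_constraintP (R : realType) (r s : R) : 0 <= r ->
  (- 1%:E - lne r%:E <= s%:E)%E <-> 0 < r /\ - 1 - ln r <= s.
Proof.
move=> r0; case: (ltP 0 r) => [rp|rn].
  by rewrite lne_EFin // -EFinN -EFinB lee_fin; split=> [|[]].
rewrite le0_lneNy ?lee_fin //=; split=> [|[]//].
by rewrite leNgt ltry.
Qed.

Lemma max_degree_gt0 (n : nat) (e : rel 'I_n) :
  has_edge e -> (0 < max_degree e)%N.
Proof.
move=> [i [j eij]]; apply: leq_trans (leq_bigmax i).
by apply/card_gt0P; exists j; rewrite inE.
Qed.

(** Attaching each [dU] term to its pair lets the objective be bounded below pair by pair. *)
Lemma dreg_objectiveE (R : realType) (n : nat) (e : rel 'I_n)
    (p : dreg_point R n) : irreflexive e ->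
  dreg_objective e p =
  \sum_(i < n) \sum_(j < n | e i j) (dS p i j + dU p i j)
  + \sum_(i < n) \sum_(j < n | (i != j) && ~~ e i j) (dV p i j + dU p i j).
Proof.
move=> eI; rewrite /dreg_objective -!big_split /=; apply: eq_bigr => i _.
rewrite !big_split /= (bigID (e i) (fun j => i != j)) /=.
have -> : \sum_(j | (i != j) && e i j) dU p i j = \sum_(j | e i j) dU p i j.
  apply: eq_bigl => j; case: eqVneq => // <-; by rewrite eI.
lra.
Qed.

Lemma dreg_optimal_radius (R : realType) (n : nat) (e : rel 'I_n) (C : R)
    (Q : 'M[R]_n) :
  simple_graph e -> has_edge e -> dreg_optimal e C Q ->
  exists i, C <= \sum_(j < n | j != i) `|Q i j|.
Proof.
move=> [eS eI] [a [b eab]] [p [<- [fS fV fU fD [pS _]] pmin]].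
apply/not_existsP => small.
have rad i : \sum_(j < n | j != i) `|dQ p i j| < C.
  by rewrite ltNge; apply/negP/small.
have ab : a != b by apply: contraTneq eab => ->; rewrite eI.
have eba : e b a by rewrite eS.
(* The perturbation enlarges only the radii of rows [a] and [b], so [eps] is the smaller slack of
   the two. *)
pose eps := Num.min (C - \sum_(j < n | j != a) `|dQ p a j|)
                    (C - \sum_(j < n | j != b) `|dQ p b j|).
have eps0 : 0 < eps by rewrite /eps lt_min !subr_gt0 !rad.
(* Both orders of the edge are perturbed, so that the new matrix stays symmetric. *)
pose T : rel 'I_n := fun i j => (i, j) \in [:: (a, b); (b, a)].
have TE i j : T i j = ((i == a) && (j == b)) || ((i == b) && (j == a)).
  by rewrite /T !inE !xpair_eqE.
have TS i j : T i j = T j i by rewrite !TE orbC andbC [X in _ || X]andbC.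
have Te i j : T i j -> e i j by rewrite TE => /orP[] /andP[/eqP-> /eqP->].
have en i j : e i j -> i != j by apply: contraTneq => ->; rewrite eI.
have rpos i j : e i j -> 0 < dR p i j /\ - 1 - ln (dR p i j) <= dS p i j.
  move=> eij; have [_ _ r0] := fU _ _ (en _ _ eij).
  by apply/lne_constraintP => //; exact: fS.
(* Raising r_ij lowers Q_ij and the bound on s_ij, while leaving u_ij alone. *)
pose q := DregPoint
  (\matrix_(i, j) (dQ p i j - eps *+ T i j))
  (\matrix_(i, j) if T i j then - 1 - ln (dR p i j + eps) else dS p i j)
  (dV p) (dU p)
  (\matrix_(i, j) (dR p i j + eps *+ T i j)).
have qf : dreg_feasible e C q.
  split=> /=.
  - move=> i j eij; rewrite !mxE; have [rp rs] := rpos _ _ eij.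
    apply/lne_constraintP; first by rewrite addr_ge0 ?mulrn_wge0 // ltW.
    case: (T i j); rewrite ?mulr1n ?mulr0n ?addr0 //.
    by split; rewrite ?addr_gt0.
  - exact: fV.
  - move=> i j ij; rewrite !mxE; have [<- u0 r0] := fU _ _ ij.
    by split=> //; [rewrite opprD addrA | rewrite addr_ge0 ?mulrn_wge0 // ltW].
  - move=> i; rewrite mxE fD TE.
    by case: (eqVneq i a) => [->|_] /=; rewrite ?(negbTE ab) ?andbF ?subr0.
  - apply: diag_dominant_psd.
      by apply/matrixP => i j; rewrite !mxE TS -{1}pS mxE.
    move=> i; rewrite mxE fD.
    have -> : T i i = false by apply/negP => /Te; rewrite eI.
    rewrite subr0.
    apply: (@le_trans _ _ (\sum_(j < n | j != i) (`|dQ p i j| + eps *+ T i j))).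
      apply: ler_sum => j _; rewrite mxE.
      apply: le_trans (ler_normB _ _) _; rewrite lerD2l.
      by rewrite ger0_norm ?mulrn_wge0 // ltW.
    rewrite big_split /= -lerBrDl.
    have [ia|ia] := eqVneq i a.
      rewrite ia (bigD1 b) 1?eq_sym //= big1 => [|j /andP[_ jb]]; last first.
        by rewrite TE (negbTE jb) andbF (negbTE ab).
      by rewrite addr0 TE !eqxx /= mulr1n /eps ge_min lexx.
    have [ib|ib] := eqVneq i b.
      rewrite ib (bigD1 a) //= big1 => [|j /andP[_ jb]]; last first.
        by rewrite TE (negbTE jb) andbF eq_sym (negbTE ab).
      by rewrite addr0 TE !eqxx orbT mulr1n /eps ge_min lexx orbT.
    rewrite big1 => [|j _]; first by rewrite subr_ge0 ltW.
    by rewrite TE (negbTE ia) (negbTE ib).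
have := pmin q qf; apply/negP; rewrite -ltNge /dreg_objective /= !ltrD2r.
have qS i j : e i j -> dS q i j <= dS p i j.
  move=> eij; rewrite mxE; case: ifP => // _.
  have [rp rs] := rpos _ _ eij; apply: le_trans rs; rewrite lerD2l lerN2.
  by rewrite ler_ln ?posrE ?addr_gt0 // lerDl ltW.
(* Strictness at a single edge suffices, since no other term of the objective increases. *)
have qSab : dS q a b < dS p a b.
  rewrite mxE TE !eqxx /=.
  have [rp rs] := rpos _ _ eab; apply: lt_le_trans rs; rewrite ltrD2l ltrN2.
  by rewrite ltr_ln ?posrE ?addr_gt0 // ltrDl.
rewrite (bigD1 a) //= [ltRHS](bigD1 a) //=; apply: ltr_leD; last first.
  by apply: ler_sum => i _; apply: ler_sum => j; exact: qS.
rewrite (bigD1 b) //= [ltRHS](bigD1 b) //=; apply: ltr_leD => //.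
by apply: ler_sum => j /andP[eaj _]; exact: qS.
Qed.

Lemma ln_le_subr1 (R : realType) (x : R) : 0 < x -> ln x <= x - 1.
Proof.
move=> x0; have := @le_ln1Dx R (x - 1); rewrite subrKC; apply.
by rewrite ltrBrDl subrr.
Qed.

(** * The perfect matching that attains the bound *)

Definition antidiag_matching (n : nat) : rel 'I_n := fun i j => j == rev_ord i.

Lemma antidiag_matchingC (n : nat) : symmetric (@antidiag_matching n).
Proof.
by move=> i j; rewrite /antidiag_matching -(inj_eq rev_ord_inj) rev_ordK eq_sym.
Qed.

(** A fixed point i would force n = 2i + 1. *)
Lemma rev_ord_neq (n : nat) (i : 'I_n) : ~~ odd n -> rev_ord i != i.
Proof.
move=> nev; apply: contraNneq nev => /(congr1 val) /= H.
have <- : (n - i.+1 + i.+1)%N = n by rewrite subnK.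
by rewrite H addnS /= addnn odd_double.
Qed.

Lemma antidiag_matching_simple (n : nat) :
  ~~ odd n -> simple_graph (@antidiag_matching n).
Proof.
move=> nev; split; first exact: antidiag_matchingC.
by move=> i; rewrite /antidiag_matching eq_sym (negbTE (rev_ord_neq _ _ nev)).
Qed.

Definition antidiag_mx (R : realType) (n : nat) : 'M[R]_n :=
  \matrix_(i, j) (j == rev_ord i)%:R.

Lemma antidiag_mx_sqr (R : realType) (n : nat) :
  antidiag_mx R n *m antidiag_mx R n = 1%:M.
Proof.
apply/matrixP => i j; rewrite !mxE (bigD1 (rev_ord i)) //= big1 => [|k ki].
  by rewrite !mxE eqxx mul1r addr0 rev_ordK eq_sym.
by rewrite !mxE (negbTE ki) mul0r.
Qed.

(* With J the antidiagonal matrix, 1 - J and 1 + J annihilate each other and sum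
   to 2, so their ranks add up to n; for n even they are conjugate by the
   diagonal matrix that changes the signs of the first n/2 coordinates. *)
Lemma mxrank_sub_antidiag (R : realType) (n : nat) :
  ~~ odd n -> (\rank (1%:M - antidiag_mx R n)).*2 = n.
Proof.
move=> nev; set J := antidiag_mx R n.
pose D : 'M[R]_n := diag_mx (\row_i (-1) ^+ (i < n./2)%N).
have DD : D *m D = 1%:M.
  rewrite mulmx_diag -diag_const_mx; congr diag_mx.
  by apply/rowP => i; rewrite !mxE -expr2 sqrr_sign.
have DJ : D *m J *m D = - J.
  apply/matrixP => i j; rewrite mul_mx_diag mul_diag_mx !mxE.
  have [->|_] := eqVneq; last by rewrite mulr0 mul0r oppr0.
  rewrite mulr1 -signr_addb.
  (* For n even, exactly one of [i] and [rev_ord i] lies in the first half, so each nonzero entry of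
     [J] changes sign. *)
  have -> : (i < n./2)%N (+) (rev_ord i < n./2)%N = true.
    have := ltn_ord i; have := odd_double_half n; rewrite (negbTE nev) add0n /=.
    rewrite -addnn; move: (n./2) => h hn ilt.
    case: (ltnP i h) => ih /=; last by rewrite ltn_subLR //; lia.
    by rewrite ltnNge negbK; lia.
  by rewrite expr1.
have conj : D *m (1%:M - J) *m D = 1%:M + J.
  by rewrite mulmxBr mulmxBl mulmx1 DD DJ opprK.
have conj' : D *m (1%:M + J) *m D = 1%:M - J.
  by rewrite mulmxDr mulmxDl mulmx1 DD DJ.
have req : \rank (1%:M + J)%R = \rank (1%:M - J).
  have le_conj X : (\rank (D *m X *m D) <= \rank X)%N.
    by rewrite (leq_trans (mxrankM_maxl _ _)) // mxrankM_maxr.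
  by apply/eqP; rewrite eqn_leq -{1}conj le_conj -conj' le_conj.
(* The vanishing product bounds the sum of the two ranks by n from above; the sum 2I, of full rank,
   bounds it from below. *)
apply/eqP; rewrite -addnn -{2}req eqn_leq; apply/andP; split.
  apply: mulmx0_rank_max; rewrite mulmxDr !mulmxBl !mulmx1 !mul1mx.
  by rewrite antidiag_mx_sqr addrA subrK subrr.
apply: leq_trans (mxrank_add _ _); rewrite addrAC addrA addrK.
have -> : 1%:M + 1%:M = 2 *: 1%:M :> 'M[R]_n by rewrite scaler_nat mulr2n.
by rewrite mxrank_scale_nz ?mxrank1 ?pnatr_eq0.
Qed.

(** The only nonzero off-diagonal entry of row i is -C, in column [rev_ord i]. *)
Lemma antidiag_radius (R : realType) (n : nat) (C : R) (i : 'I_n) :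
  ~~ odd n -> 0 <= C ->
  \sum_(j < n | j != i) `|(C *: (1%:M - antidiag_mx R n)) i j| = C.
Proof.
move=> nev C0; rewrite (bigD1 (rev_ord i)) ?rev_ord_neq //= big1 => [|j].
  rewrite !mxE eqxx eq_sym (negbTE (rev_ord_neq _ _ nev)) sub0r mulrN1 addr0.
  by rewrite normrN ger0_norm.
move=> /andP[ji jr]; rewrite !mxE eq_sym (negbTE ji) (negbTE jr).
by rewrite subrr mulr0 normr0.
Qed.

(* As |Q_ij| <= C on positive semidefinite matrices, each matched pair costs at
   least -1 - ln C and each unmatched pair at least 0. *)
Lemma antidiag_optimal (R : realType) (n : nat) (C : R) :
  ~~ odd n -> 1 <= C ->
  dreg_optimal (@antidiag_matching n) C (C *: (1%:M - antidiag_mx R n)).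
Proof.
move=> nev C1; have C0 : 0 < C by apply: lt_le_trans C1.
have [eS eI] := antidiag_matching_simple _ nev.
set e := @antidiag_matching n in eS eI *; set Q := _ *: _.
have en i j : e i j -> i != j by apply: contraTneq => ->; rewrite eI.
have QE i j : Q i j = C * ((i == j)%:R - (e i j)%:R) by rewrite !mxE.
have Qd i : Q i i = C by rewrite QE eqxx eI subr0 mulr1.
(* Matched pairs take u = 0 and r = C, unmatched ones u = r = 1; [s] and [v] make their constraints
   tight. *)
exists (DregPoint Q (const_mx (- 1 - ln C)) (const_mx (- 1))
  (\matrix_(i, j) (~~ e i j)%:R) (\matrix_(i, j) if e i j then C else 1)).
split=> //.
  split=> /=.
  - move=> i j eij; rewrite !mxE eij; apply/lne_constraintP => //.
    exact: ltW.
  - move=> i j ij eij; rewrite !mxE eij; apply/lne_constraintP => //.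
    by rewrite ln1 subr0.
  - move=> i j ij; rewrite QE !mxE (negbTE ij).
    by case: (e i j) => /=; split=> //; rewrite ?ltW //; ring.
  - exact: Qd.
  - apply: diag_dominant_psd => [|i]; last by rewrite Qd antidiag_radius // ltW.
    by apply/matrixP => i j; rewrite mxE !QE eS eq_sym.
move=> q [fS fV fU fD fpsd]; rewrite !dreg_objectiveE //=.
apply: lerD; apply: ler_sum => i _; apply: ler_sum => j.
  move=> eij; rewrite !mxE eij addr0.
  have [Eq u0 r0] := fU _ _ (en _ _ eij).
  have /(lne_constraintP _ _ _ r0)[rp rs] := fS _ _ eij.
  have := psd_offdiag_ge _ _ _ i j fpsd; rewrite !fD => Qge.
  have rC : 0 < dR q i j / C by rewrite divr_gt0.
  have := ln_le_subr1 _ _ rC; rewrite ln_div ?posrE //.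
  (* Here r = u - Q_ij <= u + C, and C >= 1 gives r/C <= 1 + u. Hence ln r - ln C <= r/C - 1 <= u,
     so s + u >= -1 - ln C. *)
  have : dR q i j / C <= 1 + dU q i j by rewrite ler_pdivrMr //; nra.
  lra.
move=> /andP[ij eij]; rewrite !mxE eij addNr.
have [Eq u0 r0] := fU _ _ ij.
have /(lne_constraintP _ _ _ u0)[up us] := fV _ _ ij eij.
have := ln_le_subr1 _ _ up; lra.
Qed.

Theorem proposition3p4 (R : realType) :
  (forall (n : nat) (e : rel 'I_n) (C : R) (Q : 'M[R]_n),
      simple_graph e -> has_edge e -> (max_degree e)%:R < C ->
      dreg_optimal e C Q ->
      gershgorin_rank_bound Q <= n%:R / 2)
  /\
  (forall n : nat, (0 < n)%N -> ~~ odd n ->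
     exists e : rel 'I_n,
       [/\ simple_graph e, has_edge e
         & forall C : R, (max_degree e)%:R < C ->
             exists Q : 'M[R]_n,
               [/\ dreg_optimal e C Q,
                   gershgorin_rank_bound Q = n%:R / 2
                 & (\rank Q)%:R = n%:R / 2 :> R]]).
Proof.
have C_ge1 n (e : rel 'I_n) (C : R) :
    has_edge e -> (max_degree e)%:R < C -> 1 <= C.
  move=> /max_degree_gt0 d0 dC; apply: ltW; apply: le_lt_trans dC.
  by rewrite ler1n.
have trQ n (Q : 'M[R]_n) C : (forall i, Q i i = C) -> \tr Q = n%:R * C.
  by move=> QC; rewrite /mxtrace (eq_bigr _ (fun i _ => QC i)) sumr_const
    card_ord mulr_natl.
split=> [n e C Q eG eE dC Qopt|n n0 nev].
  have C1 := C_ge1 _ _ _ eE dC.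
  have [i Ci] := dreg_optimal_radius _ _ _ _ _ eG eE Qopt.
  have Qd k : Q k k = C by case: Qopt => p [<- [_ _ _ + _] _].
  have : C + C <= gershgorin_norm_bound Q.
    apply: le_trans (gershgorin_norm_bound_ge _ _ _ i _); rewrite Qd ?lerD2l //.
    by apply: le_trans C1.
  rewrite /gershgorin_rank_bound (trQ _ _ C) // => GC.
  have n0 : 0 <= n%:R :> R by [].
  (* The norm bound is at least 2C > 0, which makes the quotient at most nC / 2C. *)
  by rewrite ler_pdivrMr; nra.
exists (@antidiag_matching n).
have eE : has_edge (@antidiag_matching n).
  by exists (Ordinal n0), (rev_ord (Ordinal n0)); exact: eqxx.
split=> // [|C dC]; first exact: antidiag_matching_simple.
have C1 := C_ge1 _ _ _ eE dC; have C0 : 0 < C by apply: lt_le_trans C1.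
exists (C *: (1%:M - antidiag_mx R n)); set Q := _ *: _.
have Qopt : dreg_optimal (@antidiag_matching n) C Q by apply: antidiag_optimal.
have Qd k : Q k k = C by case: Qopt => p [<- [_ _ _ + _] _].
split=> //.
  rewrite /gershgorin_rank_bound (trQ _ _ C) //.
  (* Every disk has centre C and radius C, so 2C is both an upper bound and attained. *)
  have -> : gershgorin_norm_bound Q = C + C.
    apply/eqP; rewrite eq_le; apply/andP; split.
      apply: gershgorin_norm_bound_le => // i.
      by rewrite Qd antidiag_radius ?gtr0_norm // ltW.
    have := gershgorin_norm_bound_ge _ _ Q (Ordinal n0).
    by rewrite Qd antidiag_radius // ltW // => /(_ isT).
  by field; lra.
have rk : n%:R = (\rank (1%:M - antidiag_mx R n))%:R * 2 :> R.
  by rewrite -{1}(mxrank_sub_antidiag R _ nev) -muln2 natrM.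
by rewrite mxrank_scale_nz ?gt_eqF // rk mulfK // pnatr_eq0.
Qed.
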